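(* Let $m\ge2$, $n\ge1$, $m\ge n$, $\mathfrak{g}_0=\mathfrak{so}(2m+1,2n+1)$, and let $V=V_{min}(\mathfrak{so}(2m+1,2n+1))$ be the unique minimal $(\mathfrak{g},K)$-module. The set of all Dirac triples of $V$ is $$\{(\mu_n,\rho_P^\sigma,\lambda_P)\ :\ P\subseteq N,\ |P|=m-1,\ \sigma\in\{\pm1\}\},\qquad N=\{m+n-2,\dots,2,1\}.$$
   Context: Let $\mathfrak{g}=\mathfrak{so}(2m+2n+2,\mathbb{C})$ and $\mathfrak{k}=\mathfrak{so}(2m+1,\mathbb{C})\oplus\mathfrak{so}(2n+1,\mathbb{C})$ be the complexifications of $\mathfrak{g}_0$ and of the maximal compactly embedded subalgebra $\mathfrak{k}_0$; $G$ is connected and simply connected with Lie algebra $\mathfrak{g}_0$ and $K$ its connected subgroup with Lie algebra $\mathfrak{k}_0$. $\mathfrak{t}$ is a Cartan subalgebra of $\mathfrak{k}$, $\mathfrak{h}=\mathfrak{t}\oplus\mathfrak{a}$ its centralizer in $\mathfrak{g}$ ($\dim\mathfrak{a}=1$). In standard coordinates $\mathfrak{h}^*=\mathbb{C}^{m+n+1}$, $W(\mathfrak{g},\mathfrak{h})$ acts by permutations and even numbers of sign changes, $\mathfrak{t}^*$ is the subspace where the last coordinate is $0$, and $W(\mathfrak{k},\mathfrak{t})$ acts by permutations within the first $m$ coordinates and within the next $n$ coordinates together with arbitrary sign changes of these $m+n$ coordinates. The simple roots are $\{e_i-e_{i+1}:1\le i\le m+n\}\cup\{e_{m+n}+e_{m+n+1}\}$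 for $\mathfrak{g}$ and $\{e_i-e_{i+1}:1\le i\le m+n-1,i\ne m\}\cup\{e_m,e_{m+n}\}$ for $\mathfrak{k}$. Half sums of positive roots: $\rho_{\mathfrak{g}}=(m+n,m+n-1,\dots,1,0)$ and $\rho_{\mathfrak{k}}=(m-\frac12,m-\frac32,\dots,\frac12;\,n-\frac12,n-\frac32,\dots,\frac12;\,0)$. An element is $K$-dominant if it pairs nonnegatively with all positive roots of $\mathfrak{k}$. $V$ is the unique (known) irreducible $(\mathfrak{g},K)$-module whose annihilator is the Joseph ideal. It has infinitesimal character $\lambda_0=(m+n-1,m+n-2,\dots,2,1,1,0)$, and its $K$-types, each of multiplicity one, have highest weights $\mu_s=\mu_0+s\beta$, $s=0,1,2,\dots$, with $\mu_0=(0,\dots,0;\,m-n,0,\dots,0;\,0)$ and $\beta=(1,0,\dots,0;\,1,0,\dots,0;\,0)$. Let $R_K(\mathfrak{g})$ (resp. $\Lambda_K(V)$) be the set of $K$-dominant elements of $W(\mathfrak{g},\mathfrak{h})\rho_{\mathfrak{g}}$ (resp. $W(\mathfrak{g},\mathfrak{h})\lambda_0$). For $v\in\mathfrak{t}^*$, $\{v\}$ is the unique $K$-dominant element of $W(\mathfrak{k},\mathfrak{t})v$. A Dirac triple of $V$ is a triple $(\mu,\rho,\lambda)$ with $\rho\in R_K(\mathfrak{g})$, $\lambda\in\Lambda_K(V)$, $\mu$ the highest weight of a $K$-type of $V$, and $\{\mu-\rho+\rho_{\mathfrak{k}}\}=\lambda-\rho_{\mathfrak{k}}$; in particular $\mu-\rho+\rho_{\mathfrak{k}}\in\mathfrak{t}^*$,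 so the last coordinates of $\rho$ and $\lambda$ are $0$, and this last coordinate $0$ is omitted from the notation below. For $P\subseteq N$ with $|P|=m-1$, write $P=\{a_1>\dots>a_{m-1}\}$, $N\setminus P=\{b_1>\dots>b_{n-1}\}$, and for $\sigma\in\{\pm1\}$ put $$\lambda_P=(a_1+1,\dots,a_{m-1}+1,1;\ b_1+1,\dots,b_{n-1}+1,1),$$ $$\rho_P^\sigma=\left(m+n-\tfrac{1-\sigma}{2},a_1,\dots,a_{m-1};\ m+n-\tfrac{1+\sigma}{2},b_1,\dots,b_{n-1}\right).$$ *)

(* Defs.v *)
From HB Require Import structures.
From mathcomp Require Import all_boot all_order all_algebra all_fingroup.
From mathcomp Require Import reals complex.

Set Implicit Arguments.
Unset Strict Implicit.
Unset Printing Implicit Defensive.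

Import Order.TTheory GRing.Theory Num.Theory.

Local Open Scope ring_scope.
Local Open Scope complex_scope.

(** ** The Lie algebra so(N, C) of skew-symmetric matrices *)

Section SpecialOrthogonal.
Variables (R : realType) (N : nat).

Definition skewmx : {pred 'M[R[i]]_N} := [pred A : 'M_N | A^T == - A].

Fact skewmx_submod : submod_closed skewmx.
Proof.
split; first by rewrite inE trmx0 oppr0.
move=> c A B; rewrite !inE => /eqP hA /eqP hB.
by rewrite linearP /= hA hB scalerN opprD.
Qed.

HB.instance Definition _ :=
  GRing.isSubmodClosed.Build R[i] 'M[R[i]]_N skewmx skewmx_submod.

Record so := So { so_mx :> 'M[R[i]]_N ; so_mxP : so_mx \in skewmx }.

HB.instance Definition _ := [isSub for so_mx].
HB.instance Definition _ := [Choice of so by <:].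
HB.instance Definition _ := [SubChoice_isSubLmodule of so by <:].

Fact bracket_skew (X Y : so) : X *m Y - Y *m X \in skewmx.
Proof.
rewrite inE linearB /= !trmx_mul.
have /eqP-> := so_mxP X; have /eqP-> := so_mxP Y.
by rewrite !mulNmx !mulmxN !opprK opprB.
Qed.

Definition bracket (X Y : so) : so := So (bracket_skew X Y).

Record gmodule := GModule {
  gcarrier :> lmodType R[i] ;
  gact : so -> gcarrier -> gcarrier ;
  gact_linearl : forall v, linear (fun X => gact X v) ;
  gact_linearr : forall X, linear (gact X) ;
  gact_bracket : forall X Y v,
    gact (bracket X Y) v = gact X (gact Y v) - gact Y (gact X v) }.

Definition irreducible_gmodule (V : gmodule) : Prop :=
  (exists v : V, v <> 0) /\
  forall S : V -> Prop,
    S 0 -> (forall c u v, S u -> S v -> S (c *: u + v)) ->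
    (forall X v, S v -> S (gact X v)) ->
    (forall v, S v -> v = 0) \/ (forall v, S v).

(** ** The enveloping algebra

  [U(g)] is presented as noncommutative polynomial expressions in elements of
  [g], two expressions being identified when they act in the same way on all
  [g]-modules; as [U(g)] acts faithfully on itself by left multiplication,
  this identification is equality in [U(g)]. *)

Inductive uexpr :=
  | UConst of R[i]
  | UGen of so
  | UAdd of uexpr & uexpr
  | UMul of uexpr & uexpr.

Fixpoint uact (V : gmodule) (u : uexpr) (v : V) : V :=
  match u with
  | UConst c => c *: v
  | UGen X => gact X v
  | UAdd a b => uact a v + uact b v
  | UMul a b => uact a (uact b v)
  end.

Definition ueq (a b : uexpr) : Prop :=
  forall (V : gmodule) (v : V), uact a v = uact b v.

Definition ucentral (z : uexpr) : Prop :=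
  forall X : so, ueq (UMul z (UGen X)) (UMul (UGen X) z).

Definition uideal (J : uexpr -> Prop) : Prop :=
  [/\ forall a b, ueq a b -> J a -> J b,
      J (UConst 0),
      forall a b, J a -> J b -> J (UAdd a b),
      forall a b, J b -> J (UMul a b)
    & forall a b, J a -> J (UMul a b)].

Definition completely_prime (J : uexpr -> Prop) : Prop :=
  ~ J (UConst 1) /\ forall a b, J (UMul a b) -> J a \/ J b.

Definition annihilator (V : gmodule) (u : uexpr) : Prop :=
  forall v : V, uact u v = 0.

Fixpoint udeg (u : uexpr) : nat :=
  match u with
  | UConst _ => 0
  | UGen _ => 1
  | UAdd a b => maxn (udeg a) (udeg b)
  | UMul a b => udeg a + udeg b
  end%N.

(* The homogeneous component of degree d of the image of u in S(g), seen as a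
   polynomial function on g by means of the invariant form tr(XY). When
   d = udeg u it represents the class of u in U_d / U_(d-1) = S^d(g). *)
Fixpoint usymbol (u : uexpr) (d : nat) (Y : so) : R[i] :=
  match u with
  | UConst c => if d == 0%N then c else 0
  | UGen X => if d == 1%N then \tr (X *m Y) else 0
  | UAdd a b => usymbol a d Y + usymbol b d Y
  | UMul a b => \sum_(i < d.+1) usymbol a i Y * usymbol b (d - i)%N Y
  end.

(* The zero locus of gr J. *)
Definition associated_variety (J : uexpr -> Prop) (Y : so) : Prop :=
  forall u, J u -> usymbol u (udeg u) Y = 0.

End SpecialOrthogonal.

(** ** Cartan subalgebras and roots of (so(2m+2n+2), so(2m+1) + so(2n+1)) *)

Section Pair.
Variables (R : realType) (m n : nat).

Local Notation C := R[i].

Definition dimg : nat := (m.*2.+1 + n.*2.+1)%N.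

Definition in_k (X : so R dimg) : Prop :=
  ursubmx (X : 'M_(m.*2.+1 + n.*2.+1)) = 0.

Definition rank_g : nat := (m + n).+1.

Definition weight := 'rV[C]_rank_g.

(* The j-th coordinate of h is the infinitesimal rotation, with eigenvalues
   1 and -1, in the plane spanned by the basis vectors number plane_fst j and
   plane_snd j of C^(2m+2n+2): the first m planes lie in C^(2m+1), the next n
   in C^(2n+1), and the last one (which spans a) is spanned by the remaining
   vector of each. *)
Definition plane_fst (j : nat) : nat :=
  if (j < m)%N then j.*2 else if (j < m + n)%N then j.*2.+1 else m.*2.
Definition plane_snd (j : nat) : nat :=
  if (j < m)%N then j.*2.+1 else if (j < m + n)%N then j.*2.+2
  else (m + n).*2.+1.

Definition cartan_mx (x : weight) : 'M[C]_dimg :=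
  \matrix_(a, b) \sum_(j < rank_g) x 0 j * 'i *
    (((a == plane_fst j :> nat) && (b == plane_snd j :> nat))%:R
     - ((a == plane_snd j :> nat) && (b == plane_fst j :> nat))%:R).

Fact cartan_mx_skew (x : weight) : cartan_mx x \in @skewmx R dimg.
Proof.
rewrite inE; apply/eqP/matrixP => a b; rewrite !mxE -sumrN.
apply: eq_bigr => j _; rewrite -mulrN opprB.
by congr (_ * (_ - _)); rewrite andbC.
Qed.

Definition cartan (x : weight) : so R dimg := So (cartan_mx_skew x).

Definition last_coord (v : weight) : C := v 0 ord_max.

(* Membership in t, and in t^* as the weights vanishing on a. *)
Definition in_t (v : weight) : Prop := last_coord v = 0.

Definition pairing (u v : weight) : C := \sum_(i < rank_g) u 0 i * v 0 i.

Definition eps (i : 'I_rank_g) : weight := delta_mx 0 i.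

Definition pos_root_g (alpha : weight) : Prop :=
  exists i j : 'I_rank_g,
    (i < j)%N /\ (alpha = eps i + eps j \/ alpha = eps i - eps j).

Definition pos_root_k (alpha : weight) : Prop :=
  (exists i : 'I_rank_g, (i < m + n)%N /\ alpha = eps i) \/
  (exists i j : 'I_rank_g,
     [/\ (i < j < m + n)%N, (i < m)%N = (j < m)%N
       & alpha = eps i + eps j \/ alpha = eps i - eps j]).

Definition root_vector_g (alpha : weight) (X : so R dimg) : Prop :=
  forall x : weight, bracket (cartan x) X = pairing alpha x *: X.

Definition root_vector_k (alpha : weight) (X : so R dimg) : Prop :=
  in_k X /\
  forall x : weight, in_t x -> bracket (cartan x) X = pairing alpha x *: X.

Definition highest_weight_vector_g
    (V : gmodule R dimg) (mu : weight) (v : V) : Prop :=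
  [/\ v <> 0,
      forall x : weight, gact (cartan x) v = pairing mu x *: v
    & forall alpha X, pos_root_g alpha -> root_vector_g alpha X ->
        gact X v = 0].

Definition highest_weight_vector_k
    (V : gmodule R dimg) (mu : weight) (v : V) : Prop :=
  [/\ v <> 0,
      forall x : weight, in_t x -> gact (cartan x) v = pairing mu x *: v
    & forall alpha X, pos_root_k alpha -> root_vector_k alpha X ->
        gact X v = 0].

(* The group K is Spin(2m+1) x Spin(2n+1), compact and simply connected (for
   m, n >= 1), so a (g,K)-module is a g-module on which k acts locally
   finitely; K being connected, irreducibility is that of the g-module. *)
Definition is_gK_module (V : gmodule R dimg) : Prop :=
  forall v : V, exists (d : nat) (b : 'I_d -> V),
    (exists c : 'I_d -> C, v = \sum_(i < d) c i *: b i) /\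
    (forall (X : so R dimg) (j : 'I_d), in_k X ->
       exists c : 'I_d -> C, gact X (b j) = \sum_(i < d) c i *: b i).

Definition is_Ktype (V : gmodule R dimg) (mu : weight) : Prop :=
  in_t mu /\ exists v : V, highest_weight_vector_k mu v.

Definition Ktype_multiplicity_one (V : gmodule R dimg) (mu : weight) : Prop :=
  is_Ktype V mu /\
  forall u v : V, highest_weight_vector_k mu u ->
    highest_weight_vector_k mu v -> exists c : C, v = c *: u.

(** ** Special weights *)

Definition rho_g : weight := \row_i (m + n - i)%N%:R.

Definition rho_k : weight :=
  \row_i if (i < m)%N then (m - i)%N%:R - 2%:R^-1
         else if (i < m + n)%N then (m + n - i)%N%:R - 2%:R^-1 else 0.

Definition row_of_seq (s : seq C) : weight := \row_i s`_i.

(* (m+n-1, ..., 2, 1, 1, 0) *)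
Definition lambda0 : weight :=
  row_of_seq ([seq k%:R | k <- rev (iota 1 (m + n).-1)] ++ [:: 1; 0]).

Definition beta : weight :=
  \row_i ((i == 0%N :> nat) || (i == m :> nat))%:R.

Definition mu0 : weight := \row_i (if i == m :> nat then m%:R - n%:R else 0).

Definition mu_ (s : nat) : weight := mu0 + s%:R *: beta.

(* The central character by which z acts on highest weight modules of highest
   weight chi - rho_g (such modules exist, e.g. Verma modules) is the
   Harish-Chandra character of parameter chi. *)
Definition has_infinitesimal_character
    (V : gmodule R dimg) (chi : weight) : Prop :=
  forall z : uexpr R dimg, ucentral z ->
    exists c : C,
      (forall (M : gmodule R dimg) (v : M),
         highest_weight_vector_g (chi - rho_g) v -> uact z v = c *: v) /\
      (forall v : V, uact z v = c *: v).

(** ** The Joseph ideal *)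

Definition highest_root_g : weight := \row_i (i < 2)%N%:R.

(* Closure of the minimal nilpotent orbit: 0 and the orbit of a highest root
   vector under the adjoint action of SO(2m+2n+2, C). *)
Definition min_orbit_closure (Y : so R dimg) : Prop :=
  Y = 0 \/
  exists (g : 'M[C]_dimg) (E : so R dimg),
    [/\ g *m g^T = 1%:M, \det g = 1, E <> 0,
        root_vector_g highest_root_g E
      & (Y : 'M_dimg) = g *m E *m g^T].

(* Joseph: g being simple and not of type A, exactly one ideal has this
   property. *)
Definition is_Joseph_ideal (J : uexpr R dimg -> Prop) : Prop :=
  [/\ uideal J, completely_prime J
    & forall Y, associated_variety J Y <-> min_orbit_closure Y].

Definition is_minimal_gK_module (V : gmodule R dimg) : Prop :=
  [/\ is_gK_module V, irreducible_gmodule V & is_Joseph_ideal (annihilator V)].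

(** ** Weyl groups and Dirac triples *)

Definition signed_perm (w : 'S_rank_g) (s : {set 'I_rank_g}) (v : weight)
  : weight := \row_i ((-1) ^+ (i \in s) * v 0 (w i)).

Definition W_g_orbit (v u : weight) : Prop :=
  exists (w : 'S_rank_g) (s : {set 'I_rank_g}),
    ~~ odd #|s| /\ u = signed_perm w s v.

Definition W_k_orbit (v u : weight) : Prop :=
  exists (w : 'S_rank_g) (s : {set 'I_rank_g}),
    [/\ w ord_max = ord_max, ord_max \notin s,
        forall i : 'I_rank_g, (i < m)%N = (w i < m)%N
      & u = signed_perm w s v].

Definition K_dominant (v : weight) : Prop :=
  forall alpha, pos_root_k alpha -> 0 <= pairing v alpha.

(* {v} = u, for v in t^*. *)
Definition K_dominant_conjugate (v u : weight) : Prop :=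
  [/\ in_t v, W_k_orbit v u & K_dominant u].

Definition R_K (rho : weight) : Prop := W_g_orbit rho_g rho /\ K_dominant rho.

(* Lambda_K of a module with infinitesimal character chi. *)
Definition Lambda_K (chi lambda : weight) : Prop :=
  W_g_orbit chi lambda /\ K_dominant lambda.

Definition is_Dirac_triple (V : gmodule R dimg) (chi mu rho lambda : weight)
  : Prop :=
  [/\ R_K rho, Lambda_K chi lambda, is_Ktype V mu
    & K_dominant_conjugate (mu - rho + rho_k) (lambda - rho_k)].

(** ** The parametrization by subsets P of N = {1, ..., m+n-2} *)

Definition setN : {set 'I_(m + n).-1} := [set k : 'I_(m + n).-1 | (0 < k)%N].

Definition decreasing_seq (A : {set 'I_(m + n).-1}) : seq nat :=
  sort geq [seq nat_of_ord k | k <- enum A].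

Definition lambda_P (P : {set 'I_(m + n).-1}) : weight :=
  row_of_seq ([seq (k + 1)%N%:R | k <- decreasing_seq P] ++ [:: 1] ++
              [seq (k + 1)%N%:R | k <- decreasing_seq (setN :\: P)] ++ [:: 1]).

Definition rho_P (sigma : int) (P : {set 'I_(m + n).-1}) : weight :=
  row_of_seq
    (((m + n)%N%:R - (1 - sigma%:~R) / 2%:R)
       :: [seq k%:R | k <- decreasing_seq P] ++
     ((m + n)%N%:R - (1 + sigma%:~R) / 2%:R)
       :: [seq k%:R | k <- decreasing_seq (setN :\: P)]).

End Pair.

(* Main.v *)
Require Import Defs.
From mathcomp Require Import all_boot all_order all_algebra all_fingroup.
From mathcomp Require Import reals complex.
From mathcomp Require Import zify ring.
Set Implicit Arguments.
Unset Strict Implicit.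
Unset Printing Implicit Defensive.
Import Order.TTheory GRing.Theory Num.Theory.

Local Open Scope ring_scope.

(** Once the K-types of V are known to be the mu_s, the statement is a
combinatorial identity between vectors of half-integers, and it is forced by
comparing the sums of their absolute values.

Put M = m + n and consider a Dirac triple (mu_s, rho, lambda). Since mu_s and
rho_k lie in t^*, the last coordinate of rho is 0, so the others form a
permutation of 1, ..., M that is strictly decreasing in each of the two blocks
(R_K_coords); likewise the coordinates of lambda, without the final 0, form a
permutation of M-1, ..., 2, 1, 1. Let r0 and rm be the leading coordinates of
rho in the two blocks. A strictly decreasing sequence of positive integers
dominates rho_k, so away from these two positions mu_s - rho + rho_k has
absolute value rho - rho_k. Members of W(k,t) preserve the sum of the absolute
values, and lambda - rho_k is nonnegative; equating the two sums gives

   |s + m - 1/2 - r0| + |s + m - 1/2 - rm|  =  r0 + rm + 2 - 2M.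

The two terms on the left are half-odd, hence at least 1/2, while r0 and rm are
distinct and at most M, so the right-hand side is at most 1. Hence both sides are equal to 1,
{r0, rm} = {M, M-1} and s = n (top_coords_of_conjugate).

Conversely, suppose that {r0, rm} = {M, M-1} and s = n. Then the leading entry
of each block of mu_n - rho + rho_k is 1/2 or -1/2. Moving it to the end of its
block and taking absolute values produces a K-dominant vector, namely
lambda - rho_k for the lambda obtained from rho by deleting the leading entry
of each block, adding 1 to the others and appending 1
(lambda_coords_conjugate); this lambda is in Lambda_K(V)
(lambda_coords_Lambda_K). As the K-dominant element of a W(k,t)-orbit is
unique (K_dominant_conjugate_unique), it is the only possible lambda.

What is left of rho, once r0 and rm are chosen, is the partition of
{1, ..., M-2} into the other entries of its two blocks: this is P and its
complement, and the sign sigma records which of r0, rm is M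
(rho_coords_tails, tails_exist, rho_P_tails, lambda_P_tails). *)

Section Combinatorics.
Variables (R : realType) (m n : nat).
Local Notation C := (complex R).
Local Notation M := (m + n)%N.
Local Notation weight := (weight R m n).
Implicit Types (u v : weight) (r : nat -> nat).

(** * Dominant weights and their conjugates *)

Lemma weightDE u v i : (u + v) 0 i = u 0 i + v 0 i. Proof. exact: mxE. Qed.
Lemma weightBE u v i : (u - v) 0 i = u 0 i - v 0 i. Proof. by rewrite !mxE. Qed.

Lemma pairing_eps v i : pairing v (eps R i) = v 0 i.
Proof.
rewrite /pairing (bigD1 i) //= big1 ?addr0 => [|j ne_ji].
  by rewrite /eps mxE !eqxx mulr1.
by rewrite /eps mxE (negbTE ne_ji) andbF mulr0.
Qed.

Lemma pairingDr u v v' : pairing u (v + v') = pairing u v + pairing u v'.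
Proof.
by rewrite /pairing -big_split; apply: eq_bigr => i _; rewrite mxE mulrDr.
Qed.

Lemma pairingNr u v : pairing u (- v) = - pairing u v.
Proof.
by rewrite /pairing -sumrN; apply: eq_bigr => i _; rewrite mxE mulrN.
Qed.

(** Nonnegativity on e_i + e_j follows from nonnegativity on e_i and e_j. *)
Lemma K_dominantP v : K_dominant v <->
  (forall i : 'I_(rank_g m n), (i < M)%N -> 0 <= v 0 i) /\
  (forall i j : 'I_(rank_g m n), (i < j < M)%N -> (i < m)%N = (j < m)%N ->
     v 0 j <= v 0 i).
Proof.
split=> [dom | [pos dec] alpha].
  split=> [i ltiM | i j ltij eqb].
    by rewrite -pairing_eps; apply: dom; left; exists i.
  rewrite -subr_ge0 -!pairing_eps -pairingNr -pairingDr; apply: dom; right.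
  by exists i, j; split=> //; right.
case=> [[i [ltiM ->]] | [i [j [ltij eqb alphaE]]]].
  by rewrite pairing_eps pos.
have /andP[lt_ij ltjM] := ltij; have ltiM := ltn_trans lt_ij ltjM.
case: alphaE => ->; rewrite pairingDr ?pairingNr !pairing_eps.
  by rewrite addr_ge0 ?pos.
by rewrite subr_ge0 dec.
Qed.

Lemma norm_signed_perm (w : 'S_(rank_g m n)) (s : {set 'I_(rank_g m n)}) v i :
  `|signed_perm w s v 0 i| = `|v 0 (w i)|.
Proof. by rewrite mxE normrM normrX normrN1 expr1n mul1r. Qed.

Lemma ord_le (i : 'I_(rank_g m n)) : (i <= M)%N.
Proof. by rewrite -ltnS; apply: ltn_ord. Qed.

Lemma ord_lastP (i : 'I_(rank_g m n)) : i = ord_max \/ (i < M)%N.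
Proof.
have [->|] := eqVneq i ord_max; first by left.
rewrite -val_eqE /= => ne_iM; right.
by rewrite ltn_neqAle ne_iM ord_le.
Qed.

(** A K-dominant representative carries no sign information: it lists the
absolute values of the coordinates, permuted inside the blocks. *)
Lemma K_dominant_conjugate_norm v u : K_dominant_conjugate v u ->
  exists w : 'S_(rank_g m n),
    [/\ w ord_max = ord_max, forall i : 'I_(rank_g m n), (i < m)%N = (w i < m)%N
      & forall i, u 0 i = `|v 0 (w i)|].
Proof.
case=> tv [w [s [w_last _ w_m uE]]] /K_dominantP[pos _].
exists w; split=> // i; rewrite -(norm_signed_perm w s) -uE.
have [-> | ltiM] := ord_lastP i; last by rewrite ger0_norm ?pos.
by apply/eqP; rewrite uE mxE w_last -[v 0 _]/(last_coord v) tv mulr0 normr0.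
Qed.

(** Pigeonhole. The two representatives differ by a permutation p that preserves
the blocks. It cannot inject the positions up to i of a block into those
before i, so it sends some j <= i to p j >= i; monotonicity on both sides then
gives u' i <= u' j = u (p j) <= u i. *)
Lemma K_dominant_conjugate_le v u u' :
  K_dominant_conjugate v u -> K_dominant_conjugate v u' ->
  forall i, u' 0 i <= u 0 i.
Proof.
move=> cu cu'; have [w [w_last w_m uE]] := K_dominant_conjugate_norm cu.
have [w' [w'_last w'_m u'E]] := K_dominant_conjugate_norm cu'.
have [_ _ /K_dominantP[_ dec]] := cu; have [_ _ /K_dominantP[_ dec']] := cu'.
pose p := (w' * w^-1)%g.
have upE i : u' 0 i = u 0 (p i) by rewrite u'E uE permM permKV.
have p_last : p ord_max = ord_max by rewrite permM w'_last -{1}w_last permK.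
have p_m (i : 'I__) : (p i < m)%N = (i < m)%N by rewrite w_m permM permKV -w'_m.
move=> i; have [-> | ltiM] := ord_lastP i; first by rewrite upE p_last.
pose S := [set j : 'I_(rank_g m n) | (j <= i)%N && ((j < m)%N == (i < m)%N)].
have iS : i \in S by rewrite inE leqnn eqxx.
have: ~~ (p @: S \subset S :\ i).
  apply/negP => /subset_leq_card; rewrite card_imset; last exact: perm_inj.
  by rewrite (cardsD1 i S) iS ltnn.
case/subsetPn => _ /imsetP[j + ->]; rewrite !inE => /andP[leji /eqP eqji].
rewrite p_m eqji eqxx andbT negb_and negbK -ltnNge => ge_pj.
have le_uj : u 0 (p j) <= u 0 i.
  case/orP: ge_pj => [/eqP-> // | lt_ip]; apply: dec; last by rewrite p_m.
  rewrite lt_ip /=; have [pjE | //] := ord_lastP (p j).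
  by move: leji; rewrite (perm_inj (etrans pjE (esym p_last))) /= leqNgt ltiM.
rewrite (le_trans _ le_uj) // -upE.
have [-> // | ne_ji] := eqVneq j i; apply: dec' => //.
by rewrite ltiM andbT ltn_neqAle leji andbT; apply: contraNneq ne_ji => /val_inj->.
Qed.

Lemma K_dominant_conjugate_unique v u u' :
  K_dominant_conjugate v u -> K_dominant_conjugate v u' -> u = u'.
Proof.
move=> cu cu'; apply/rowP => i; apply/le_anti.
by rewrite !(K_dominant_conjugate_le cu cu', K_dominant_conjugate_le cu' cu).
Qed.

(** * Elements of R_K with last coordinate zero *)

Definition nat_weight r : weight := \row_i (r i)%:R.

(** Injectivity on {0, ..., M} with values in the same set makes r, restricted to
it, a permutation: this is how the orbit of rho_g is encoded. *)
Definition rho_coords r : Prop :=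
  [/\ {in gtn M.+1 &, injective r}, forall i, (i <= M)%N -> (r i <= M)%N, r M = 0%N
    & forall i j, (i < j < M)%N -> (i < m)%N = (j < m)%N -> (r j < r i)%N].

Lemma signed_nat_ge0 (b : bool) (k : nat) : 0 <= (-1) ^+ b * k%:R :> C ->
  (-1) ^+ b * k%:R = k%:R :> C.
Proof.
by move=> /ger0_norm <-; rewrite normrM normrX normrN1 expr1n mul1r normr_nat.
Qed.

Lemma R_K_coords (rho : weight) : R_K rho -> last_coord rho = 0 ->
  exists2 r, rho_coords r & rho = nat_weight r.
Proof.
case=> -[w [s [_ ->]]] /K_dominantP[pos dec]; rewrite /last_coord.
set rho' := signed_perm w s _ in pos dec * => last0.
pose r i : nat := (M - w (inord i))%N.
have rE i : rho' 0 i = (r i)%:R.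
  rewrite /r inord_val; have [-> | /pos] := ord_lastP i; last first.
    by rewrite !mxE; apply: signed_nat_ge0.
  rewrite last0; move/eqP: (last0).
  by rewrite /rho' !mxE mulf_eq0 signr_eq0 /= => /eqP->.
exists r; last by apply/rowP => i; rewrite rE mxE.
have r_inj : {in gtn M.+1 &, injective r}.
  move=> i j; rewrite !inE => lti ltj; rewrite /r => eqr.
  have eqw : w (inord i) = w (inord j).
    apply: ord_inj.
    by move: (ord_le (w (inord i))) (ord_le (w (inord j))) eqr; lia.
  by have /(congr1 val) := perm_inj eqw; rewrite /= !inordK.
have rM : r M = 0%N.
  apply/eqP; rewrite -(pnatr_eq0 C) -[M in r M]/(val (@ord_max M)) -rE.
  exact/eqP.
split=> // [i leiM | i j ltij eqb]; first exact: leq_subr.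
have /andP[lt_ij ltjM] := ltij; have ltiM := ltn_trans lt_ij ltjM.
rewrite ltn_neqAle; apply/andP; split.
  by apply/eqP => /r_inj; rewrite !inE => /(_ _ _); lia.
have := dec (inord i) (inord j); rewrite !rE !inordK; try lia.
by rewrite ler_nat; apply.
Qed.

Lemma K_dominant_nat_weight r :
  (forall i j, (i < j < M)%N -> (i < m)%N = (j < m)%N -> (r j <= r i)%N) ->
  K_dominant (nat_weight r).
Proof.
move=> dec; apply/K_dominantP; split=> [i _ | i j ltij eqb]; rewrite !mxE //.
by rewrite ler_nat dec.
Qed.

Lemma ord_perm (N : nat) (f : nat -> nat) :
    (forall i, (i < N)%N -> (f i < N)%N) -> {in gtn N &, injective f} ->
  exists w : 'S_N, forall i, w i = f i :> nat.
Proof.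
move=> f_lt f_inj; pose g (i : 'I_N) := Ordinal (f_lt i (ltn_ord i)).
have g_inj : injective g.
  move=> i j /(congr1 val) /= /f_inj.
  by rewrite !inE !ltn_ord => /(_ isT isT)/ord_inj.
by exists (perm g_inj) => i; rewrite permE.
Qed.

Lemma rho_coords_perm r : rho_coords r ->
  exists w : 'S_(rank_g m n), forall i, (w i + r i = M)%N.
Proof.
case=> r_inj r_le _ _.
have [i _ | i j lti ltj eqr | w wE] := @ord_perm M.+1 (fun i => M - r i)%N.
- by rewrite ltnS leq_subr.
- by apply: r_inj => //; move: (r_le _ lti) (r_le _ ltj) eqr; lia.
by exists w => i; rewrite wE subnK // r_le // ord_le.
Qed.

Lemma coords_R_K r : rho_coords r -> R_K (nat_weight r).
Proof.
move=> cr; have [_ _ _ dec] := cr; have [w wE] := rho_coords_perm cr.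
split; last by apply: K_dominant_nat_weight => i j ltij /(dec i j ltij)/ltnW.
exists w, set0; rewrite cards0; split=> //; apply/rowP => i.
by rewrite !mxE inE mul1r; congr (_%:R); have := wE i; lia.
Qed.

(** One past the last position of the block of i. On that block rho_k is
block_end i - i - 1/2, which lets both blocks be treated at once. *)
Definition block_end (i : nat) : nat := if (i < m)%N then m else M.

Lemma rho_kE (i : 'I_(rank_g m n)) : (i < M)%N ->
  rho_k R m n 0 i = (block_end i - i)%N%:R - 2%:R^-1.
Proof. by move=> ltiM; rewrite mxE /block_end ltiM; case: ifP. Qed.

Lemma rho_k_last : rho_k R m n 0 ord_max = 0.
Proof. by rewrite mxE /= ltnn ltnNge leq_addr. Qed.

Lemma rho_coords_gap r i k : rho_coords r -> (i + k < M)%N ->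
  (i < m)%N = (i + k < m)%N -> (r (i + k) + k <= r i)%N.
Proof.
case=> _ _ _ dec; elim: k => [|k IHk] ltM eqb; first by rewrite !addn0.
have eqb' : (i < m)%N = (i + k < m)%N by move: eqb; lia.
have := IHk _ eqb'; have := dec (i + k)%N (i + k.+1)%N; rewrite -eqb -eqb' addnS.
by move=> /(_ _ erefl); lia.
Qed.

Lemma rho_coords_gt0 r i : rho_coords r -> (i < M)%N -> (0 < r i)%N.
Proof.
case=> r_inj _ r_last _ ltiM; rewrite lt0n; apply/eqP => ri0.
by have := r_inj i M; rewrite !inE ltnSn leqW // ri0 r_last => /(_ _ _ _); lia.
Qed.

(** From i to the end of its block there are block_end i - i positive values,
strictly decreasing. This is what makes rho - rho_k nonnegative. *)
Lemma rho_coords_ge r i : rho_coords r -> (i < M)%N -> (block_end i - i <= r i)%N.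
Proof.
move=> cr ltiM; pose k := ((block_end i).-1 - i)%N.
have [ltM eqb ltk] : [/\ (i + k < M)%N, (i < m)%N = (i + k < m)%N
                       & (block_end i - i <= k.+1)%N].
  by rewrite /k /block_end; case: ifP => ? ; split; lia.
have := rho_coords_gap cr ltM eqb; have := rho_coords_gt0 cr ltM; lia.
Qed.

(** * The weight lambda attached to rho *)

(** Forced by the requirement that lambda - rho_k list the absolute values of
mu_n - rho + rho_k in decreasing order: r (i + 1) moves to position i, where
rho_k is larger by 1, and the leading entry of the block, which has absolute
value 1/2, goes to the end, where rho_k is 1/2. *)
Definition lambda_coords r (i : nat) : nat :=
  if i.+1 == block_end i then 1%N else if (i < M)%N then (r i.+1).+1 else 0%N.

Lemma lambda_coords_last r : lambda_coords r M = 0%N.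
Proof. by rewrite /lambda_coords /block_end; do !case: ifP; lia. Qed.

Lemma lambda_coords_ge r i : rho_coords r -> (i < M)%N ->
  (block_end i - i <= lambda_coords r i)%N.
Proof.
move=> cr ltiM; rewrite /lambda_coords ltiM; case: eqP => [<- | ne]; first by lia.
have := @rho_coords_ge r i.+1 cr; move: ne; rewrite /block_end.
by case: ifP; case: ifP => *; lia.
Qed.

Lemma lambda_coords_gap r i j : rho_coords r -> (i < j < M)%N ->
  (i < m)%N = (j < m)%N -> (lambda_coords r j + (j - i) <= lambda_coords r i)%N.
Proof.
move=> cr /andP[ltij ltjM] eqb; have eqe : block_end i = block_end j.
  by rewrite /block_end eqb.
have ltiM := ltn_trans ltij ltjM.
have lejE : (j < block_end j)%N by rewrite /block_end; case: ifP.
have := lambda_coords_ge cr ltiM; rewrite /lambda_coords eqe ltiM ltjM.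
have -> : (i.+1 == block_end j) = false by lia.
case: eqP => [<- | ne]; first by lia.
have := @rho_coords_gap r i.+1 (j - i) cr; rewrite addSn subnKC ?(ltnW ltij) //.
by move=> /(_ _ _); move: ne lejE eqb; rewrite /block_end; case: ifP => *; lia.
Qed.

Lemma lambda_coords_dominant r : rho_coords r ->
  K_dominant (nat_weight (lambda_coords r) - rho_k R m n).
Proof.
move=> cr.
have entry (i : 'I_(rank_g m n)) : (i < M)%N ->
    (nat_weight (lambda_coords r) - rho_k R m n) 0 i
    = (lambda_coords r i - (block_end i - i))%N%:R + 2%:R^-1.
  move=> ltiM; rewrite weightBE rho_kE // mxE [in RHS]natrB ?lambda_coords_ge //.
  by rewrite opprB addrA addrAC.
apply/K_dominantP; split=> [i ltiM | i j ltij eqb].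
  by rewrite entry // addr_ge0 ?invr_ge0 ?ler0n.
have /andP[lt_ij ltjM] := ltij; have ltiM := ltn_trans lt_ij ltjM.
rewrite !entry // lerD2r ler_nat; have := lambda_coords_gap cr ltij eqb.
have -> : block_end i = block_end j by rewrite /block_end eqb.
have := lambda_coords_ge cr ltjM; lia.
Qed.

(** * Coordinates of mu - rho + rho_k *)

Definition block_start (i : nat) : nat := if (i < m)%N then 0%N else m.

(** In both blocks the leading entry of mu_s + rho_k is s + m - 1/2: the entry
m - n of mu_0 compensates the difference of the lengths of the blocks. *)
Lemma shifted_start s r (i : 'I_(rank_g m n)) :
  (i < M)%N -> i = block_start i :> nat ->
  (mu_ R m n s - nat_weight r + rho_k R m n) 0 i
  = ((s + m).*2%:Z - 1 - (r i).*2%:Z)%:~R / 2%:R.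
Proof.
move=> ltiM eqi; rewrite [LHS]weightDE rho_kE // !mxE /block_end.
move: eqi; rewrite /block_start; case: ifP => ltim ->; rewrite -!mul2n.
  have -> : (0 == m :> nat)%N = false by lia.
  by rewrite eqxx /= subn0; field.
by rewrite eqxx orbT subDnCA // subnn addn0 /=; field.
Qed.

Lemma shifted_inner s r (i : 'I_(rank_g m n)) :
  (i < M)%N -> i != block_start i :> nat ->
  (mu_ R m n s - nat_weight r + rho_k R m n) 0 i
  = - ((r i)%:R - rho_k R m n 0 i).
Proof.
move=> ltiM ne; rewrite [LHS]weightDE; set k := rho_k _ _ _ _ _; rewrite !mxE.
have -> : (i == m :> nat) = false.
  by move: ne; rewrite /block_start; case: ifP; lia.
have -> : (i == 0 :> nat)%N = false.
  by move: ne; rewrite /block_start; case: ifP; lia.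
by rewrite /= mulr0 !add0r; ring.
Qed.

Lemma shifted_last s (rho : weight) : (1 <= m)%N -> (1 <= n)%N ->
  last_coord (mu_ R m n s - rho + rho_k R m n) = - last_coord rho.
Proof.
move=> m_gt0 n_gt0; rewrite /last_coord [LHS]weightDE rho_k_last !mxE /=.
have -> : (m + n == m)%N = false by lia.
have -> : (m + n == 0)%N = false by lia.
by rewrite mulr0 !add0r addr0.
Qed.

Lemma shifted_nat_weight_last s r : (1 <= m)%N -> (1 <= n)%N -> rho_coords r ->
  last_coord (mu_ R m n s - nat_weight r + rho_k R m n) = 0.
Proof.
move=> m_gt0 n_gt0 [_ _ r_last _].
by rewrite shifted_last // /last_coord mxE r_last oppr0.
Qed.

Lemma rho_coords_excess_ge0 r (i : 'I_(rank_g m n)) : rho_coords r -> (i < M)%N ->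
  0 <= (r i)%:R - rho_k R m n 0 i.
Proof.
move=> cr ltiM; rewrite rho_kE // opprB addrA addrAC -natrB ?rho_coords_ge //.
by rewrite addr_ge0 ?invr_ge0 ?ler0n.
Qed.

(** The leading entries of rho forced by the comparison of sums below. *)
Definition top_coords r : Prop :=
  (r 0%N = M /\ r m = M.-1) \/ (r 0%N = M.-1 /\ r m = M).

(** * Existence of lambda *)

(** The rotation by one step of each block, which brings the leading entry of a
block to its end. *)
Definition shift (i : nat) : nat :=
  if i.+1 == block_end i then block_start i else if (i < M)%N then i.+1 else i.

Lemma shift_le i : (i <= M)%N -> (shift i <= M)%N.
Proof.
by move=> leiM; rewrite /shift /block_start; case: ifP => *; case: ifP => *; lia.
Qed.

Lemma shift_last : shift M = M.
Proof. by rewrite /shift /block_end; do !case: ifP; lia. Qed.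

Lemma shift_inj : {in gtn M.+1 &, injective shift}.
Proof.
move=> i j; rewrite !inE /shift /block_end /block_start.
by do !case: ifP; lia.
Qed.

Lemma shift_perm : exists w : 'S_(rank_g m n), forall i, w i = shift i :> nat.
Proof.
by apply: ord_perm; [move=> i; rewrite !ltnS; apply: shift_le | apply: shift_inj].
Qed.

(** Rotating each block and adjusting signs turns mu_n - rho + rho_k into
lambda - rho_k: an inner entry of rho - rho_k is unchanged by the rotation,
since rho_k drops by 1 and lambda adds 1, and the leading entry 1/2 or -1/2
becomes the final entry 1 - 1/2. *)
Lemma lambda_coords_conjugate r : (1 <= m)%N -> (1 <= n)%N ->
    rho_coords r -> top_coords r ->
  K_dominant_conjugate (mu_ R m n n - nat_weight r + rho_k R m n)
                       (nat_weight (lambda_coords r) - rho_k R m n).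
Proof.
move=> m_gt0 n_gt0 cr top; set v := _ + _; set u := nat_weight _ - _.
have [_ _ r_last _] := cr.
have tv : last_coord v = 0 by apply: shifted_nat_weight_last.
have [w wE] := shift_perm.
have w_last : w ord_max = ord_max.
  by apply: ord_inj; rewrite wE shift_last.
have w_block (i : 'I_(rank_g m n)) : (i < m)%N = (w i < m)%N.
  have := ord_le i; rewrite wE /shift /block_end /block_start.
  by do !case: ifP; lia.
have uE i : u 0 i = v 0 (w i) \/ u 0 i = - v 0 (w i).
  have [-> | ltiM] := ord_lastP i.
    left; rewrite w_last [RHS]tv weightBE rho_k_last subr0 mxE.
    by rewrite lambda_coords_last.
  have ltwM : (w i < M)%N.
    by rewrite wE /shift /block_end /block_start; do !case: ifP; lia.
  have [is_end | inner] := eqVneq i.+1 (block_end i).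
    have wiE : w i = block_start (w i) :> nat.
      by rewrite wE /shift is_end eqxx /block_start; do !case: ifP; lia.
    rewrite /v shifted_start //.
    have -> : u 0 i = 2%:R^-1.
      rewrite weightBE rho_kE // mxE /lambda_coords is_end eqxx.
      by rewrite -{1}is_end subSnn opprB addrCA subrr addr0.
    have [rw | rw] : r (w i) = M \/ r (w i) = M.-1.
    - by move: wiE top; rewrite /block_start /top_coords; case: ifP => _ ->; lia.
    - right; rewrite rw addnC; have -> : M.*2%:Z - 1 - M.*2%:Z = -1 by lia.
      by rewrite mulNr opprK mul1r.
    left; rewrite rw addnC; have -> : M.*2%:Z - 1 - M.-1.*2%:Z = 1 by lia.
    by rewrite mul1r.
  have wiE : w i = i.+1 :> nat by rewrite wE /shift (negbTE inner) ltiM.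
  right; rewrite /v shifted_inner // ?opprK.
    rewrite weightBE !rho_kE // mxE /lambda_coords (negbTE inner) ltiM wiE.
    have -> : block_end i.+1 = block_end i by rewrite -wiE /block_end -w_block.
    have -> : (block_end i - i = (block_end i - i.+1).+1)%N.
      by move: inner; rewrite /block_end; case: ifP; lia.
    by rewrite -!natr1; ring.
  by rewrite wiE; move: inner; rewrite /block_start /block_end; do !case: ifP; lia.
split=> //; last exact: lambda_coords_dominant.
exists w, [set i | u 0 i != v 0 (w i)]; split=> //.
  by case: (uE ord_max); rewrite inE negbK w_last [v 0 _]tv => ->; rewrite ?oppr0.
apply/rowP => i; rewrite [RHS]mxE inE.
case: eqVneq => [-> | ne]; first by rewrite mul1r.
by case: (uE i) ne => ->; rewrite ?eqxx // mulN1r.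
Qed.

(** The entry of index M-1 is the second 1 of lambda_0. *)
Definition lambda0_coords (j : nat) : nat :=
  if (j < M.-1)%N then (M.-1 - j)%N else (j == M.-1).

Lemma lambda0E : lambda0 R m n = nat_weight lambda0_coords.
Proof.
apply/rowP => i; rewrite !mxE nth_cat size_map size_rev size_iota /lambda0_coords.
case: ltnP => [lti | gei].
  rewrite (nth_map 0%N) ?size_rev ?size_iota // nth_rev ?size_iota //.
  by rewrite nth_iota ?size_iota; last lia; congr (_%:R); lia.
case: eqP => [-> | ne]; first by rewrite subnn.
have -> : (i - M.-1 = 1)%N by have := ord_le i; lia.
by [].
Qed.

(** The permutation is a product of three: the rotation of the blocks, then w
with r i = M - w i, then rot2, which reads the entries M, M-1 of rho as the two
entries 1 of lambda_0 and an entry k < M-1 as the entry k + 1 of lambda_0. *)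
Lemma lambda_coords_Lambda_K r : (2 <= m)%N -> (1 <= n)%N ->
    rho_coords r -> top_coords r ->
  Lambda_K (lambda0 R m n) (nat_weight (lambda_coords r)).
Proof.
move=> m_ge2 n_gt0 cr top; split; last first.
  by apply: K_dominant_nat_weight => i j ltij /(lambda_coords_gap cr ltij); lia.
have [w wE] := rho_coords_perm cr; have [c cE] := shift_perm.
pose rot2 j := if (j < 2)%N then (j + M - 2)%N
               else if (j < M)%N then (j - 2)%N else j.
have [d dE] : exists d : 'S_(rank_g m n), forall i, d i = rot2 i :> nat.
  apply: ord_perm => [i | i j]; rewrite ?inE /rot2 /rank_g;
  by do !case: ifP; lia.
exists (c * w * d)%g, set0; rewrite cards0; split=> //.
apply/rowP => i; rewrite lambda0E !mxE inE mul1r !permM dE; congr (_%:R).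
have := wE (c i); rewrite cE.
have [-> | ltiM] := ord_lastP i.
  have [_ _ r_last _] := cr; rewrite shift_last r_last addn0 => ->.
  by rewrite lambda_coords_last /lambda0_coords /rot2; do !case: ifP; lia.
rewrite /shift /lambda_coords ltiM; case: ifP => [_ | inner].
  rewrite /block_start; case: ifP => _; case: top => -[r0E rmE];
  by rewrite ?r0E ?rmE /lambda0_coords /rot2; do !case: ifP; lia.
have [r_inj r_le _ _] := cr.
have r_small : (0 < r i.+1 < M.-1)%N.
  have ltSM : (i.+1 < M)%N by move: inner; rewrite /block_end; case: ifP; lia.
  rewrite rho_coords_gt0 //=.
  have := r_inj i.+1 0%N; have := r_inj i.+1 m; rewrite !inE ltnS ltnW //.
  move=> /(_ isT) nem /(_ isT) ne0; move: (r_le _ (ltnW ltSM)).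
  have nm : i.+1 != m by move: inner; rewrite /block_end; case: ifP; lia.
  by move: top nem ne0; rewrite /top_coords; lia.
by rewrite /lambda0_coords /rot2; do !case: ifP; lia.
Qed.

(** * The sum of the absolute values *)

Lemma sum_ltn N a : (a <= N)%N -> (\sum_(i < N) (i < a) = a)%N.
Proof.
elim: N a => [|N IHN] a; first by rewrite big_ord0; lia.
rewrite big_ord_recr /= leq_eqVlt => /orP[/eqP-> | ltaN].
  rewrite ltnSn (eq_bigr (fun i : 'I_N => nat_of_bool (i < N)%N)) ?IHN ?addn1 //.
  by move=> i _; rewrite ltn_ord ltnW // ltnS ltn_ord.
by rewrite IHN // ltnNge -ltnS ltaN addn0.
Qed.

(** lambda_0 is obtained from rho_g by lowering the first M-1 entries by 1. *)
Lemma sum_rho_coords r : (0 < M)%N -> rho_coords r ->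
  (\sum_(i < rank_g m n) r i = \sum_(i < rank_g m n) lambda0_coords i + M.-1)%N.
Proof.
move=> M_gt0 cr; have [w wE] := rho_coords_perm cr.
rewrite -(@sum_ltn (rank_g m n) M.-1) ?(leqW (leq_pred _)) // -big_split /=.
rewrite [RHS](reindex_inj (@perm_inj _ w)); apply: eq_bigr => i _ /=.
have := wE i; have := ord_le (w i); rewrite /lambda0_coords => lew wEi.
by do !case: ifP; lia.
Qed.

Lemma Lambda_K_sum (lambda : weight) : Lambda_K (lambda0 R m n) lambda ->
  last_coord lambda = 0 ->
  \sum_i lambda 0 i = (\sum_(i < rank_g m n) lambda0_coords i)%:R.
Proof.
case=> -[w [s [_ lambdaE]]] /K_dominantP[pos _] last0.
rewrite natr_sum [RHS](reindex_inj (@perm_inj _ w)); apply: eq_bigr => i _ /=.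
have lambda_ge0 : 0 <= lambda 0 i.
  by have [-> | /pos//] := ord_lastP i; rewrite [lambda _ _]last0.
rewrite -(ger0_norm lambda_ge0) lambdaE norm_signed_perm lambda0E mxE.
by rewrite normr_nat.
Qed.

(** The sum of |v i| - (r i - rho_k i), where v = mu_s - rho + rho_k, is 1 - M,
because the sum of |v i| is that of lambda - rho_k. Only the leading positions
of the two blocks contribute to it, whence
|s + m - 1/2 - r 0| + |s + m - 1/2 - r m| = r 0 + r m + 2 - 2M. *)
Lemma top_coords_of_conjugate s r (lambda : weight) :
    (1 <= m)%N -> (1 <= n)%N -> rho_coords r ->
    Lambda_K (lambda0 R m n) lambda ->
    K_dominant_conjugate (mu_ R m n s - nat_weight r + rho_k R m n)
                         (lambda - rho_k R m n) ->
  s = n /\ top_coords r.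
Proof.
move=> m_gt0 n_gt0 cr Llambda conj; set v := _ + _ in conj.
have [r_inj r_le r_last _] := cr.
have tv : last_coord v = 0 by apply: shifted_nat_weight_last.
have [w [w_last _ uE]] := K_dominant_conjugate_norm conj.
have lambda_last : last_coord lambda = 0.
  by have := uE ord_max; rewrite weightBE rho_k_last subr0 w_last [v _ _]tv normr0.
have sum_v : \sum_i `|v 0 i| = \sum_i lambda 0 i - \sum_i rho_k R m n 0 i.
  rewrite (reindex_inj (@perm_inj _ w)) -sumrB; apply: eq_bigr => i _.
  by rewrite -uE weightBE.
pose D i : C := `|v 0 i| - ((r i)%:R - rho_k R m n 0 i).
have sum_D : \sum_i D i = - (M.-1)%:R.
  rewrite !sumrB sum_v (Lambda_K_sum Llambda lambda_last) -natr_sum.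
  by rewrite (sum_rho_coords _ cr) ?addn_gt0 ?m_gt0 // natrD; ring.
have ltmM : (m < M)%N by lia.
pose im : 'I_(rank_g m n) := Ordinal (leqW ltmM).
have D_start (i : 'I_(rank_g m n)) : (i < M)%N -> i = block_start i :> nat ->
    D i = `|(s + m).*2%:Z - 1 - (r i).*2%:Z|%:~R / 2%:R - (r i)%:R
          + (block_end i - i)%N%:R - 2%:R^-1.
  move=> ltiM is_start; rewrite /D /v shifted_start // rho_kE // normrM.
  by rewrite -intr_norm (ger0_norm (_ : 0 <= 2%:R^-1)) ?invr_ge0 ?ler0n //; ring.
have D_inner i : i != ord0 -> i != im -> D i = 0.
  rewrite -!val_eqE /= => ne0 nem; have [-> | ltiM] := ord_lastP i.
    by rewrite /D [v _ _]tv normr0 r_last rho_k_last !subr0.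
  rewrite /D /v shifted_inner //; last by rewrite /block_start; case: ifP.
  by rewrite normrN ger0_norm ?subrr // rho_coords_excess_ge0.
have ne_m0 : im != ord0 by rewrite -val_eqE /=; lia.
move: sum_D; rewrite (bigD1 ord0) //= (bigD1 im) //=.
rewrite big1 => [|i /andP[]]; last exact: D_inner.
rewrite addr0 !D_start //=; try by rewrite /block_start ?m_gt0 ?ltnn //; lia.
rewrite /block_end ltnn m_gt0 subn0 addKn => eqC.
have {eqC} :
    `|(s + m).*2%:Z - 1 - (r 0%N).*2%:Z| + `|(s + m).*2%:Z - 1 - (r m).*2%:Z|
    = (r 0%N).*2%:Z + (r m).*2%:Z + 2 - (m.*2%:Z + n.*2%:Z + (M.-1).*2%:Z).
  (* The equation is doubled to clear the halves of rho_k and becomes one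
     between integers. *)
  apply: (@intr_inj C).
  set a := `|_|; set b := `|_|; rewrite -/a -/b in eqC.
  have -> : (a + b)%:~R
      = 2%:R * (a%:~R / 2%:R - (r 0%N)%:R + m%:R - 2%:R^-1 +
                (b%:~R / 2%:R - (r m)%:R + n%:R - 2%:R^-1))
        + 2%:R * (r 0%N)%:R + 2%:R * (r m)%:R + 2%:R
        - 2%:R * m%:R - 2%:R * n%:R :> C.
    by field.
  by rewrite eqC -!mul2n; ring.
(* Both absolute values are odd, and r 0 + r m <= 2M - 1. *)
have := r_inj 0%N m; rewrite !inE => /(_ _ _) ne.
have := (r_le 0%N); have := r_le m.
rewrite /top_coords; lia.
Qed.

(** * The parametrization by subsets *)

Implicit Types (A P : {set 'I_M.-1}).

Lemma mem_decreasing_seq A (k : 'I_M.-1) : (val k \in decreasing_seq A) = (k \in A).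
Proof. by rewrite mem_sort mem_map ?mem_enum //; apply: val_inj. Qed.

Lemma decreasing_seq_lt A k : k \in decreasing_seq A -> (k < M.-1)%N.
Proof. by rewrite mem_sort => /mapP[i _ ->]. Qed.

Lemma size_decreasing_seq A : size (decreasing_seq A) = #|A|.
Proof. by rewrite size_sort size_map cardE. Qed.

Lemma decreasing_seq_sorted A : sorted gtn (decreasing_seq A).
Proof.
rewrite gtn_sorted_uniq_geq sort_uniq map_inj_uniq ?enum_uniq /=; last first.
  exact: val_inj.
by apply: sort_sorted => i j; apply: leq_total.
Qed.

Lemma decreasing_seq_eq A s : sorted gtn s -> {in s, forall k, k < M.-1}%N ->
  (forall k : 'I_M.-1, (k \in A) = (val k \in s)) -> decreasing_seq A = s.
Proof.
move=> s_sorted s_lt memA.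
apply: (irr_sorted_eq (leT := gtn)) => //; first exact: (rev_trans ltn_trans).
- exact: ltnn.
- exact: decreasing_seq_sorted.
move=> k; case: (ltnP k M.-1) => [ltk | gek].
  by rewrite -[k]/(val (Ordinal ltk)) mem_decreasing_seq memA.
by apply/idP/idP => [/decreasing_seq_lt | /s_lt]; rewrite ltnNge gek.
Qed.

Definition tails r P : Prop :=
  decreasing_seq P = mkseq (fun i => r i.+1) m.-1 /\
  decreasing_seq (setN m n :\: P) = mkseq (fun j => r (m + j).+1) n.-1.

Definition sign_coords (sigma : int) r : Prop :=
  (sigma = 1 /\ (r 0%N = M /\ r m = M.-1)) \/
  (sigma = -1 /\ (r 0%N = M.-1 /\ r m = M)).

Lemma mkseq_cat (T : Type) (f : nat -> T) p q :
  mkseq f (p + q) = mkseq f p ++ mkseq (fun j => f (p + j)%N) q.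
Proof.
by rewrite /mkseq iotaD map_cat add0n -[p in iota p q]addn0 iotaDl -map_comp.
Qed.

Lemma map_mkseq (T U : Type) (g : T -> U) (f : nat -> T) p :
  map g (mkseq f p) = mkseq (g \o f) p.
Proof. by rewrite /mkseq -map_comp. Qed.

Lemma mem_mkseqP (T : eqType) (f : nat -> T) p x :
  reflect (exists2 i, (i < p)%N & x = f i) (x \in mkseq f p).
Proof.
by apply: (iffP mapP) => -[i lti ->]; exists i; rewrite // mem_iota in lti *.
Qed.

Lemma mkseq_first (T : Type) (f : nat -> T) p : (0 < p)%N ->
  mkseq f p = f 0%N :: mkseq (fun i => f i.+1) p.-1.
Proof. by case: p => // p _; apply: (mkseq_cat f 1 p). Qed.

Lemma mkseq_last (T : Type) (f : nat -> T) p : (0 < p)%N ->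
  mkseq f p = rcons (mkseq f p.-1) (f p.-1).
Proof. by case: p => // p _; rewrite mkseqS. Qed.

Lemma eq_in_mkseq (T : Type) (f g : nat -> T) p :
  (forall i, (i < p)%N -> f i = g i) -> mkseq f p = mkseq g p.
Proof.
elim: p => // p IHp eqfg; rewrite !mkseqS eqfg ?ltnSn // IHp // => i lti.
by rewrite eqfg // ltnW.
Qed.

Lemma row_of_mkseq r : r M = 0%N ->
  row_of_seq m n (mkseq (fun i => (r i)%:R : C) M) = nat_weight r.
Proof.
move=> r_last; apply/rowP => i; rewrite !mxE.
have [-> | ltiM] := ord_lastP i; last by rewrite nth_mkseq.
by rewrite nth_default ?size_mkseq // r_last.
Qed.

Lemma rho_P_tails sigma r P : (1 <= m)%N -> (1 <= n)%N -> r M = 0%N ->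
  sign_coords sigma r -> tails r P -> rho_P R sigma P = nat_weight r.
Proof.
move=> m_gt0 n_gt0 r_last rE [PE NE]; rewrite -row_of_mkseq // /rho_P PE NE.
rewrite mkseq_cat [X in _ = row_of_seq _ _ (X ++ _)]mkseq_first //.
rewrite [X in _ = row_of_seq _ _ (_ ++ X)]mkseq_first // addn0 /=.
have -> : M%:R - (1 - sigma%:~R) / 2%:R = (r 0%N)%:R :> C.
  case: rE => -[-> [-> _]]; first by rewrite subrr mul0r subr0.
  by rewrite -subn1 natrB ?addn_gt0 ?m_gt0 //; field.
have -> : M%:R - (1 + sigma%:~R) / 2%:R = (r m)%:R :> C.
  case: rE => -[-> [_ ->]]; last by rewrite subrr mul0r subr0.
  by rewrite -subn1 natrB ?addn_gt0 ?m_gt0 //; field.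
rewrite !map_mkseq; congr (row_of_seq _ _ (_ :: _ ++ _ :: _)).
by apply: eq_mkseq => j /=; rewrite addnS.
Qed.

Lemma lambda_P_tails r P : (1 <= m)%N -> (1 <= n)%N ->
  tails r P -> lambda_P R P = nat_weight (lambda_coords r).
Proof.
move=> m_gt0 n_gt0 [PE NE]; rewrite -row_of_mkseq ?lambda_coords_last //.
rewrite /lambda_P PE NE.
rewrite mkseq_cat [X in _ = row_of_seq _ _ (X ++ _)]mkseq_last //.
rewrite [X in _ = row_of_seq _ _ (_ ++ X)]mkseq_last // cat_rcons -cats1.
have -> : lambda_coords r m.-1 = 1%N.
  by rewrite /lambda_coords /block_end; do !case: ifP; lia.
have -> : lambda_coords r (m + n.-1) = 1%N.
  by rewrite /lambda_coords /block_end; do !case: ifP; lia.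
rewrite !map_mkseq; congr (row_of_seq _ _ (_ ++ _ :: _ ++ _)).
  apply: eq_in_mkseq => i lti /=; congr (_%:R).
  by rewrite /lambda_coords /block_end; do !case: ifP; lia.
apply: eq_in_mkseq => i lti /=; congr (_%:R).
by rewrite /lambda_coords /block_end; do !case: ifP; lia.
Qed.

Lemma sorted_mkseq_gtn (f : nat -> nat) p :
  (forall i j, (i < j < p)%N -> (f j < f i)%N) -> sorted gtn (mkseq f p).
Proof.
move=> dec; apply/(sortedP 0%N) => i; rewrite size_mkseq => lti.
by rewrite !nth_mkseq ?(ltnW lti) //=; apply: dec; rewrite ltnSn.
Qed.

(** The tails of the blocks have their values in {1, ..., M-2}, because M and M-1
are used up by the leading entries, and together they exhaust that set. *)
Lemma rho_coords_tails r : (1 <= m)%N -> (1 <= n)%N ->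
  rho_coords r -> top_coords r ->
  exists P, [/\ P \subset setN m n, #|P| = m.-1 & tails r P].
Proof.
move=> m_gt0 n_gt0 cr top; have [r_inj r_le r_last dec] := cr.
have inj i j : (i <= M)%N -> (j <= M)%N -> r i = r j -> i = j.
  by move=> lei lej; apply: r_inj; rewrite inE ltnS.
have small i : (i < M)%N -> i != 0%N -> i != m -> (0 < r i < M.-1)%N.
  move=> ltiM ne0 nem; rewrite rho_coords_gt0 //=.
  have := inj i 0%N (ltnW ltiM) isT; have := inj i m (ltnW ltiM) (leq_addr _ _).
  by move: (r_le _ (ltnW ltiM)) top; rewrite /top_coords; lia.
pose a := mkseq (fun i => r i.+1) m.-1.
pose b := mkseq (fun j => r (m + j).+1) n.-1.
pose P := [set k : 'I_M.-1 | val k \in a].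
have aE : decreasing_seq P = a.
  apply: decreasing_seq_eq => [|k|k]; last by rewrite inE.
    by apply: sorted_mkseq_gtn => i j ltij; apply: dec; lia.
  by case/mem_mkseqP=> i lti ->; have := small i.+1; lia.
exists P; split; last split=> //.
- apply/subsetP => k; rewrite !inE => /mem_mkseqP[i lti ->].
  by have := small i.+1; lia.
- by rewrite -size_decreasing_seq aE size_mkseq.
have [w wE] := rho_coords_perm cr.
apply: decreasing_seq_eq => [|k|k].
- by apply: sorted_mkseq_gtn => i j ltij; apply: dec; lia.
- by case/mem_mkseqP=> i lti ->; have := small (m + i).+1; lia.
rewrite !inE; apply/andP/idP => [[nota k_gt0] | /mem_mkseqP[j ltj kE]].
  (* The position where r takes the value k. *)
  pose i := (w^-1)%g (inord (M - k)).
  have riE : r i = k.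
    have := wE i; rewrite /i permKV inordK ?ltnS ?leq_subr //.
    by have := ltn_ord k; lia.
  have ltkM := ltn_ord k; have leiM := ord_le i.
  have ne0 : i != 0%N :> nat.
    by apply/eqP => i0; move: riE top; rewrite i0 /top_coords; lia.
  have nem : i != m :> nat.
    by apply/eqP => im; move: riE top; rewrite im /top_coords; lia.
  have neM : i != M :> nat by apply/eqP => iM; move: riE; rewrite iM r_last; lia.
  case: (ltnP i m) => [ltim | lemi].
    case/negP: nota; apply/mem_mkseqP; exists i.-1; first by lia.
    by rewrite prednK ?riE //; lia.
  apply/mem_mkseqP; exists (i - m.+1)%N; first by lia.
  by rewrite -addSn subnKC ?riE //; lia.
rewrite kE; split.
  apply/mem_mkseqP => -[i lti /inj]; lia.
by rewrite -[nat_of_ord k]/(val k) kE; have := small (m + j).+1; lia.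
Qed.

(** The leading entries exceed every element of {1, ..., M-2}, so putting them in
front of P and of its complement keeps both blocks strictly decreasing. *)
Lemma tails_exist P sigma : (1 <= m)%N -> (1 <= n)%N ->
    P \subset setN m n -> #|P| = m.-1 -> sigma = 1 \/ sigma = -1 ->
  exists r, [/\ rho_coords r, sign_coords sigma r & tails r P].
Proof.
move=> m_gt0 n_gt0 subP cardP sigmaE.
pose a := decreasing_seq P; pose b := decreasing_seq (setN m n :\: P).
have size_a : size a = m.-1 by rewrite size_decreasing_seq.
have size_b : size b = n.-1.
  rewrite size_decreasing_seq cardsD (setIidPr subP) cardP.
  have -> : #|setN m n| = M.-2.
    have M1_gt0 : (0 < M.-1)%N by lia.
    have -> : setN m n = [set~ Ordinal M1_gt0].
      by apply/setP => k; rewrite !inE -val_eqE lt0n.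
    by rewrite cardsC1 card_ord.
  by lia.
have b_gt0 k : k \in b -> (0 < k)%N.
  move=> kb; have ltk := decreasing_seq_lt kb; move: kb.
  by rewrite -[k]/(val (Ordinal ltk)) mem_decreasing_seq !inE => /andP[].
have a_gt0 k : k \in a -> (0 < k)%N.
  move=> ka; have ltk := decreasing_seq_lt ka; move: ka.
  rewrite -[k]/(val (Ordinal ltk)) mem_decreasing_seq.
  by move=> /(subsetP subP); rewrite inE.
have disj k : k \in a -> k \in b -> False.
  move=> ka; have ltk := decreasing_seq_lt ka; move: ka.
  by rewrite -[k]/(val (Ordinal ltk)) !mem_decreasing_seq => kP; rewrite inE kP.
have a_lt k : k \in a -> (k < M.-1)%N by apply: decreasing_seq_lt.
have b_lt k : k \in b -> (k < M.-1)%N by apply: decreasing_seq_lt.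
have [r0 [r1 [sign ne01]]] : exists r0 r1 : nat,
   ((sigma = 1 /\ (r0 = M /\ r1 = M.-1)) \/ (sigma = -1 /\ (r0 = M.-1 /\ r1 = M)))
   /\ r0 != r1.
  by case: sigmaE => ->; [exists M, M.-1 | exists M.-1, M]; split; tauto || lia.
have [r0_bd r1_bd] : (M.-1 <= r0 <= M)%N /\ (M.-1 <= r1 <= M)%N by lia.
pose r i := nth 0%N ((r0 :: a) ++ (r1 :: b)) i.
have rl i : (i < m)%N -> r i = nth 0%N (r0 :: a) i.
  by move=> lti; rewrite /r nth_cat /= size_a prednK // lti.
have rr j : r (m + j)%N = nth 0%N (r1 :: b) j.
  by rewrite /r nth_cat /= size_a prednK // ltnNge leq_addr addKn.
have size_s : size ((r0 :: a) ++ (r1 :: b)) = M.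
  by rewrite size_cat /= size_a size_b; lia.
have uniq_dec A : uniq (decreasing_seq A).
  by have := decreasing_seq_sorted A; rewrite gtn_sorted_uniq_geq => /andP[].
have [r0_ge r1_ge] : (M.-1 <= r0 /\ M.-1 <= r1)%N by lia.
have big_notin A k : (M.-1 <= k)%N -> k \notin decreasing_seq A.
  by move=> gek; apply/negP => /decreasing_seq_lt; rewrite ltnNge gek.
(* The value 0 is appended because r vanishes at M, which is past the end of
   the sequence. *)
have uniq_s : uniq (rcons ((r0 :: a) ++ (r1 :: b)) 0%N).
  rewrite rcons_uniq mem_cat !inE negb_or; apply/andP; split.
    rewrite !negb_or -!andbA; apply/and4P; split; try lia.
      by apply/negP => /a_gt0.
    by apply/negP => /b_gt0.
  rewrite cat_uniq /= !big_notin // !uniq_dec !andbT /= in_cons !negb_or.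
  rewrite eq_sym ne01 big_notin //=.
  apply/hasPn => k kb; rewrite /= in_cons negb_or; apply/andP; split.
    by have := b_lt _ kb; lia.
  by apply/negP => /disj/(_ kb).
have rE i : r i = nth 0%N (rcons ((r0 :: a) ++ (r1 :: b)) 0%N) i.
  by rewrite nth_rcons /r; case: ltnP => // gei; rewrite if_same nth_default.
have block_dec t c i j : (M.-1 <= t)%N -> {in c, forall l, l < M.-1}%N ->
    sorted gtn c -> (i < j < (size c).+1)%N ->
  (nth 0 (t :: c) j < nth 0 (t :: c) i)%N.
  move=> get c_lt c_sorted /andP[ltij ltj].
  apply: (@sorted_ltn_nth _ gtn (rev_trans ltn_trans) 0%N (t :: c)) => //=; last first.
    by rewrite inE (ltn_trans ltij).
  rewrite (path_sortedE (rev_trans ltn_trans)) c_sorted andbT.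
  by apply/allP => l /c_lt ltl; apply: leq_trans get.
exists r; split.
- split=> [i j lti ltj | i _ | | i j].
  + by rewrite !rE => /eqP; rewrite nth_uniq // ?size_rcons ?size_s // => /eqP.
  + case: (ltnP i M) => [ltiM | geiM]; last by rewrite /r nth_default ?size_s.
    have /mem_nth : (i < size ((r0 :: a) ++ r1 :: b))%N by rewrite size_s.
    move=> /(_ 0%N); rewrite -/(r i) mem_cat !inE.
    by case/orP=> /orP[/eqP-> | ]; move=> *; try lia;
       [have := a_lt (r i) | have := b_lt (r i)]; lia.
  + by rewrite /r nth_default ?size_s.
  move=> /andP[ltij ltjM] eqb; case: (ltnP j m) => [ltjm | lemj].
    have ltim := ltn_trans ltij ltjm; rewrite !rl //; apply: block_dec => //.
      exact: decreasing_seq_sorted.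
    by rewrite size_a; lia.
  have lemi : (m <= i)%N by lia.
  rewrite -(subnKC lemi) -(subnKC lemj) !rr; apply: block_dec => //.
    exact: decreasing_seq_sorted.
  by rewrite size_b; lia.
- by rewrite /sign_coords /= rl // -[m in r m]addn0 rr.
split; rewrite -/a -/b.
  rewrite -[LHS](mkseq_nth 0%N) size_a; apply: eq_in_mkseq => i lti.
  by rewrite rl //; lia.
rewrite -[LHS](mkseq_nth 0%N) size_b; apply: eq_in_mkseq => i lti.
by rewrite -addnS rr.
Qed.

End Combinatorics.

Theorem proposition4p3 (R : realType) (m n : nat)
    (hm : (2 <= m)%N) (hn : (1 <= n)%N) (hmn : (n <= m)%N)
    (V : gmodule R (dimg m n))
    (hV : is_minimal_gK_module V)
    (hchi : has_infinitesimal_character V (lambda0 R m n))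
    (hKtypes : forall mu : weight R m n,
        is_Ktype V mu <-> exists s : nat, mu = mu_ R m n s)
    (hmult : forall s : nat, Ktype_multiplicity_one V (mu_ R m n s))
    (mu rho lambda : weight R m n) :
  is_Dirac_triple V (lambda0 R m n) mu rho lambda <->
  exists (P : {set 'I_(m + n).-1}) (sigma : int),
    [/\ P \subset setN m n, #|P| = m.-1, (sigma = 1 \/ sigma = -1) &
        [/\ mu = mu_ R m n n, rho = rho_P R sigma P & lambda = lambda_P R P]].
Proof.
have m_gt0 := ltnW hm.
split=> [[Rrho Llambda /hKtypes[s ->] conj] | ].
  have rho_last : last_coord rho = 0.
    have [tv _ _] := conj.
    by apply: oppr_inj; rewrite -(shifted_last s) // tv oppr0.
  have [r cr rhoE] := R_K_coords Rrho rho_last.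
  rewrite {}rhoE in conj *.
  have [sE top] := top_coords_of_conjugate m_gt0 hn cr Llambda conj.
  rewrite {}sE in conj *.
  have lambdaE : lambda = nat_weight R m n (lambda_coords m n r).
    have conj' := lambda_coords_conjugate R m_gt0 hn cr top.
    exact: addIr (K_dominant_conjugate_unique conj conj').
  have [P [subP cardP tailsP]] := rho_coords_tails m_gt0 hn cr top.
  have [_ _ r_last _] := cr.
  have [sigma [sigmaE sign]] : exists sigma : int,
      (sigma = 1 \/ sigma = -1) /\ sign_coords m n sigma r.
    by rewrite /sign_coords; case: top; [exists 1 | exists (-1)]; split; tauto.
  exists P, sigma; split=> //; split=> //.
    by rewrite (rho_P_tails R m_gt0 hn r_last sign tailsP).
  by rewrite lambdaE (lambda_P_tails R m_gt0 hn tailsP).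
case=> P [sigma [subP cardP sigmaE [-> -> ->]]].
have [r [cr sign tailsP]] := tails_exist m_gt0 hn subP cardP sigmaE.
have top : top_coords m n r by move: sign; rewrite /sign_coords /top_coords; tauto.
have [_ _ r_last _] := cr.
rewrite (rho_P_tails R m_gt0 hn r_last sign tailsP).
rewrite (lambda_P_tails R m_gt0 hn tailsP).
split; first exact: coords_R_K.
- exact: lambda_coords_Lambda_K.
- by apply/hKtypes; exists n.
exact: lambda_coords_conjugate.
Qed.
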